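(* \begin{align*} \mathrm{VConv}(U,F)=\bigoplus_{k=0}^n\mathrm{VConv}_k(U,F) \end{align*}
   Context: $F$ is a locally convex vector space, $U\subset\mathbb{R}^n$ an open convex set, $\mathrm{Conv}(U,\mathbb{R})$ the space of finite-valued convex functions on $U$ with the topology of uniform convergence on compact subsets. $\mathrm{VConv}(U,F)$ is the space of all continuous valuations $\mu:\mathrm{Conv}(U,\mathbb{R})\to F$ that are dually epi-translation invariant, i.e. $\mu(f+l)=\mu(f)$ for all affine $l:\mathbb{R}^n\to\mathbb{R}$; $\mathrm{VConv}_k(U,F)$ is the subspace of $k$-homogeneous ones, i.e. $\mu(tf)=t^k\mu(f)$ for all $t\ge0$.
   Formalization: The locally convex vector space F is assumed to be Hausdorff, a common convention not stated explicitly; without it the decomposition fails, e.g. for F with the indiscrete topology and a discontinuous additive function of the jump of f' at a point. *)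

(* Defs.v *)
From HB Require Import structures.
From mathcomp Require Import all_boot all_order all_algebra.
From mathcomp Require Import all_classical all_reals all_analysis.
Set Implicit Arguments. Unset Strict Implicit. Unset Printing Implicit Defensive.
Import Order.TTheory GRing.Theory Num.Theory.
Import numFieldNormedType.Exports.
Local Open Scope classical_set_scope.
Local Open Scope ring_scope.

(* R^n is modelled by row vectors 'rV[R]_n. A function f : 'rV[R]_n -> R
   belongs to Conv(U,R) iff it is convex on U (values outside U are irrelevant). *)
Definition ConvU (R : realType) (n : nat) (U : set 'rV[R]_n)
  (f : 'rV[R]_n -> R) : Prop :=
  @convex_function R 'rV[R]_n U f.

Definition affine_fun (R : realType) (n : nat) (l : 'rV[R]_n -> R) : Prop :=
  exists (a : 'rV[R]_n) (c : R), forall x, l x = \sum_(i < n) a 0 i * x 0 i + c.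

Definition is_valuation (R : realType) (n : nat) (F : tvsType R)
  (U : set 'rV[R]_n) (mu : ('rV[R]_n -> R) -> F) : Prop :=
  forall f g, ConvU U f -> ConvU U g ->
    ConvU U (fun x => Num.min (f x) (g x)) ->
    mu (fun x => Num.max (f x) (g x)) + mu (fun x => Num.min (f x) (g x))
    = mu f + mu g.

(* continuity of mu on Conv(U,R) w.r.t. the topology of uniform convergence
   on compact subsets of U (basic neighbourhoods of f:
   {g | sup_K |g - f| < eps}, K compact in U, eps > 0). *)
Definition conv_continuous (R : realType) (n : nat) (F : tvsType R)
  (U : set 'rV[R]_n) (mu : ('rV[R]_n -> R) -> F) : Prop :=
  forall f, ConvU U f -> forall W : set F, nbhs (mu f) W ->
    exists (K : set 'rV[R]_n) (eps : R),
      [/\ compact K, K `<=` U, 0 < eps &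
        forall g, ConvU U g -> (forall x, K x -> `|g x - f x| < eps) ->
          W (mu g)].

Definition dually_epi_translation_invariant (R : realType) (n : nat)
  (F : tvsType R) (U : set 'rV[R]_n) (mu : ('rV[R]_n -> R) -> F) : Prop :=
  forall f l, ConvU U f -> affine_fun l -> mu (fun x => f x + l x) = mu f.

Definition VConv (R : realType) (n : nat) (F : tvsType R)
  (U : set 'rV[R]_n) (mu : ('rV[R]_n -> R) -> F) : Prop :=
  [/\ is_valuation U mu, conv_continuous U mu &
      dually_epi_translation_invariant U mu].

Definition VConv_k (R : realType) (n : nat) (F : tvsType R)
  (U : set 'rV[R]_n) (k : nat) (mu : ('rV[R]_n -> R) -> F) : Prop :=
  VConv U mu /\
  forall f (t : R), ConvU U f -> 0 <= t -> mu (fun x => t * f x) = t ^+ k *: mu f.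

(* Main.v *)
Require Import Defs.
From HB Require Import structures.
From mathcomp Require Import all_boot all_order all_algebra.
From mathcomp Require Import all_classical all_reals all_analysis.
From mathcomp Require Import lra zify.
Import Order.TTheory GRing.Theory Num.Theory.
Import numFieldNormedType.Exports.
Local Open Scope classical_set_scope.
Local Open Scope ring_scope.

(* Everything follows from the fact that t |-> mu(t f) is a polynomial of degree
   at most n on [0, +oo[: its coefficients are the homogeneous components.

   Let M = max(a, l) with l affine. The functions s a + M and s M + l have
   maximum (s + 1) M and minimum s a + l, so the valuation property and
   invariance give
     mu((s + 1) M) - mu(s M) = mu(s a + M) - mu(s a).
   The right-hand side is the invariant valuation mu(. + M) - mu at s a, hence by
   induction s |-> mu(s M) has vanishing m-th differences on the naturals when M
   is a maximum of m affine functions.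

   To replace m by n + 1, let nu(f) be an (n+1)-st difference of s |-> mu(s f);
   it is a valuation. Among n + 2 or more affine functions there is an affine
   dependence of the linear parts, i.e. a convex combination of some of them, J,
   lies below a convex combination of the others, I. Then the alternating sum of
   nu(max(I, T)) over T in J vanishes, which expresses nu(max(I, J)) through
   maxima of fewer functions; so nu vanishes on all maxima of affine functions.

   Such maxima are dense in Conv(U, R), because convex functions on U have
   subgradients and are continuous, so nu = 0. Applied to mu(. / N), this shows
   that j |-> mu((j / N) f) is polynomial in j; the polynomials for the various N
   agree by interpolation at integer dilates, and continuity in t concludes. *)

(** * Convex functions and maxima of affine functions *)

Section ConvexFunctions.
Context {R : realType} {n : nat}.
Implicit Types (U : set 'rV[R]_n) (f g h : 'rV[R]_n -> R).

Lemma ConvUP U f : ConvU U f <->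
  forall t x y, 0 <= t <= 1 -> U x -> U y ->
    f (t *: x + (1 - t) *: y) <= t * f x + (1 - t) * f y.
Proof.
split=> [cf t x y /andP[t0 t1] Ux Uy|cf t x y /set_mem Ux /set_mem Uy].
  have := cf (Itv01 t0 t1) x y (mem_set Ux) (mem_set Uy).
  by rewrite convRE.
rewrite convRE; apply: cf => //; exact/andP.
Qed.

Lemma convex_setP U : convex_set (U : set (convex_lmodType 'rV[R]_n)) ->
  forall t x y, 0 <= t <= 1 -> U x -> U y -> U (t *: x + (1 - t) *: y).
Proof.
move=> cU t x y /andP[t0 t1] Ux Uy.
exact: set_mem (cU x y (Itv01 t0 t1) (mem_set Ux) (mem_set Uy)).
Qed.

Lemma ConvUD U f g : ConvU U f -> ConvU U g -> ConvU U (fun x => f x + g x).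
Proof.
move=> /ConvUP cf /ConvUP cg; apply/ConvUP => t x y t01 Ux Uy.
have := cf t x y t01 Ux Uy; have := cg t x y t01 Ux Uy; lra.
Qed.

Lemma ConvUZ U c f : 0 <= c -> ConvU U f -> ConvU U (fun x => c * f x).
Proof.
move=> c0 /ConvUP cf; apply/ConvUP => t x y t01 Ux Uy.
have := ler_wpM2l c0 (cf t x y t01 Ux Uy); lra.
Qed.

Lemma ConvU_max U f g : ConvU U f -> ConvU U g ->
  ConvU U (fun x => Num.max (f x) (g x)).
Proof.
move=> /ConvUP cf /ConvUP cg; apply/ConvUP => t x y t01 Ux Uy.
have /andP[t0 t1] := t01.
have s0 : 0 <= 1 - t by lra.
have fx : f x <= Num.max (f x) (g x) by rewrite le_max lexx.
have fy : f y <= Num.max (f y) (g y) by rewrite le_max lexx.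
have gx : g x <= Num.max (f x) (g x) by rewrite le_max lexx orbT.
have gy : g y <= Num.max (f y) (g y) by rewrite le_max lexx orbT.
rewrite ge_max; apply/andP; split.
  by apply: le_trans (cf t x y t01 Ux Uy) _; rewrite lerD// ler_wpM2l.
by apply: le_trans (cg t x y t01 Ux Uy) _; rewrite lerD// ler_wpM2l.
Qed.

(** Coding by pairs makes finite families into lists with membership and permutations, and linear
    combinations componentwise. *)
Definition affine (p : 'rV[R]_n * R) (x : 'rV[R]_n) : R :=
  \sum_(i < n) p.1 0 i * x 0 i + p.2.

Lemma affine_funE p : affine_fun (affine p).
Proof. by case: p => a c; exists a, c. Qed.

Lemma affineD p x y : affine p (x + y) = affine p x + affine p y - p.2.
Proof.
rewrite /affine; under eq_bigr do rewrite mxE mulrDr.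
rewrite big_split/=; lra.
Qed.

Lemma affine_conv p t x y :
  affine p (t *: x + (1 - t) *: y) = t * affine p x + (1 - t) * affine p y.
Proof.
rewrite /affine !mulrDr !mulr_sumr.
under eq_bigr do rewrite !mxE mulrDr.
rewrite big_split/=.
under eq_bigr do rewrite mulrCA.
rewrite addrACA -mulrDl [t + _]addrC subrK mul1r; congr (_ + _ + _).
by apply: eq_bigr => i _; rewrite mulrCA.
Qed.

Lemma affine_comb {I : Type} (r : seq I) (P : pred I) (c : I -> R)
    (p : I -> 'rV[R]_n * R) x :
  affine (\sum_(i <- r | P i) c i *: (p i).1, \sum_(i <- r | P i) c i * (p i).2) x
  = \sum_(i <- r | P i) c i * affine (p i) x.
Proof.
rewrite /affine/= [RHS](eq_bigr (fun i => \sum_(j < n) c i * ((p i).1 0 j * x 0 j)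
   + c i * (p i).2)); last by move=> i _; rewrite mulrDr mulr_sumr.
rewrite big_split/= exchange_big/=; congr (_ + _).
apply: eq_bigr => j _; rewrite summxE mulr_suml; apply: eq_bigr => i _.
by rewrite mxE mulrA.
Qed.

Lemma ConvU_affine U p : ConvU U (affine p).
Proof. by apply/ConvUP => t x y _ _ _; rewrite affine_conv. Qed.

(** The separate head [p0] keeps the family nonempty. *)
Definition max_affine (p0 : 'rV[R]_n * R) (ps : seq ('rV[R]_n * R)) :
    'rV[R]_n -> R :=
  foldr (fun p f x => Num.max (f x) (affine p x)) (affine p0) ps.

Lemma ConvU_max_affine U p0 ps : ConvU U (max_affine p0 ps).
Proof.
elim: ps => [|p ps IH]; first exact: ConvU_affine.
exact: ConvU_max IH (ConvU_affine _ _).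
Qed.

Lemma max_affine_le p0 ps x y :
  (max_affine p0 ps x <= y) = all (fun p => affine p x <= y) (p0 :: ps).
Proof.
elim: ps => [|p ps IH] /=; first by rewrite andbT.
by rewrite ge_max IH /= -andbA [X in _ && X]andbC.
Qed.

Lemma max_affine_ge p0 ps p x : p \in p0 :: ps ->
  affine p x <= max_affine p0 ps x.
Proof.
have := max_affine_le p0 ps x (max_affine p0 ps x); rewrite lexx => /esym/allP.
exact.
Qed.

Lemma max_affine_perm p0 ps q0 qs : perm_eq (p0 :: ps) (q0 :: qs) ->
  max_affine p0 ps = max_affine q0 qs.
Proof.
move=> pq; apply/funext => x; apply/eqP; rewrite eq_le.
apply/andP; split.
  by rewrite max_affine_le (perm_all _ pq) -max_affine_le.
by rewrite max_affine_le -(perm_all _ pq) -max_affine_le.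
Qed.

End ConvexFunctions.

(** * Operations preserving valuations and invariance *)

Section Valuations.
Context {R : realType} {n : nat} {F : tvsType R} {U : set 'rV[R]_n}.
Implicit Types (mu nu : ('rV[R]_n -> R) -> F) (f g h : 'rV[R]_n -> R).

Definition invariant_valuation mu :=
  is_valuation U mu /\ dually_epi_translation_invariant U mu.

Lemma invariant_valuation_translate mu h : ConvU U h ->
  invariant_valuation mu -> invariant_valuation (fun f => mu (fun x => f x + h x)).
Proof.
move=> ch [vmu imu]; split=> [f g cf cg cfg|f l cf al]; last first.
  rewrite -(imu _ l (ConvUD _ _ _ cf ch) al); congr mu.
  by apply/funext => x; rewrite addrAC.
rewrite -[RHS]vmu; try exact: ConvUD.
  by congr (mu _ + mu _); apply/funext => x; rewrite ?addr_maxl ?addr_minl.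
have -> : (fun x => Num.min (f x + h x) (g x + h x)) =
  (fun x => Num.min (f x) (g x) + h x) by apply/funext => x; rewrite addr_minl.
exact: ConvUD.
Qed.

Lemma affine_funZ c l : @affine_fun R n l -> affine_fun (fun x => c * l x).
Proof.
move=> [a [b lE]]; exists (c *: a), (c * b) => x.
rewrite lE mulrDr mulr_sumr; congr (_ + _).
by apply: eq_bigr => i _; rewrite mxE mulrA.
Qed.

Lemma is_valuation_dilate mu c : 0 <= c ->
  is_valuation U mu -> is_valuation U (fun f => mu (fun x => c * f x)).
Proof.
move=> c0 vmu f g cf cg cfg.
rewrite -[RHS]vmu; try exact: ConvUZ.
  by congr (mu _ + mu _); apply/funext => x; rewrite ?maxr_pMr ?minr_pMr.
have -> : (fun x => Num.min (c * f x) (c * g x)) =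
  (fun x => c * Num.min (f x) (g x)) by apply/funext => x; rewrite minr_pMr.
exact: ConvUZ.
Qed.

Lemma invariant_dilate mu c : 0 <= c ->
  dually_epi_translation_invariant U mu ->
  dually_epi_translation_invariant U (fun f => mu (fun x => c * f x)).
Proof.
move=> c0 imu f l cf al.
rewrite -(imu _ (fun x => c * l x) (ConvUZ _ _ _ c0 cf) (affine_funZ c _ al)).
by congr mu; apply/funext => x; rewrite mulrDr.
Qed.

Lemma invariant_valuationB mu nu : invariant_valuation mu ->
  invariant_valuation nu -> invariant_valuation (fun f => mu f - nu f).
Proof.
move=> [vmu imu] [vnu inu]; split=> [f g cf cg cfg|f l cf al].
  by rewrite addrACA vmu// -opprD vnu// opprD addrACA.
by rewrite imu// inu.
Qed.

Lemma is_valuation_sum (I : finType) (a : I -> R) (mu : I -> ('rV[R]_n -> R) -> F) :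
  (forall i, is_valuation U (mu i)) ->
  is_valuation U (fun f => \sum_i a i *: mu i f).
Proof.
move=> vmu f g cf cg cfg; rewrite -!big_split/=.
by apply: eq_bigr => i _; rewrite -!scalerDr vmu.
Qed.

Lemma invariant_sum (I : finType) (a : I -> R) (mu : I -> ('rV[R]_n -> R) -> F) :
  (forall i, dually_epi_translation_invariant U (mu i)) ->
  dually_epi_translation_invariant U (fun f => \sum_i a i *: mu i f).
Proof. by move=> imu f l cf al; apply: eq_bigr => i _; rewrite imu. Qed.

End Valuations.

(** * Finite differences of sequences *)

Section FiniteDifferences.
Context {V : zmodType}.
Implicit Types u v : nat -> V.

Fixpoint fdiff m u : nat -> V :=
  if m is m'.+1 then fdiff m' (fun s => u s.+1 - u s) else u.

Lemma fdiffS m u s : fdiff m.+1 u s = fdiff m u s.+1 - fdiff m u s.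
Proof. by elim: m u => [|m IH] u //; rewrite [LHS]IH. Qed.

Lemma fdiff_eq0 m k u : (m <= k)%N -> (forall s, fdiff m u s = 0) ->
  forall s, fdiff k u s = 0.
Proof.
move=> /subnK <- u0; elim: (k - m)%N => [|j IH] s //.
by rewrite addSn fdiffS !IH subrr.
Qed.

(** Serves with [P] the valuation property or continuity, which thus pass from dilates to their
    differences. *)
Lemma fdiff_closed {T : Type} (P : (T -> V) -> Prop) :
  (forall a b, P a -> P b -> P (fun x => a x - b x)) ->
  forall m (u : nat -> T -> V) s, (forall s, P (u s)) ->
    P (fun x => fdiff m (u^~ x) s).
Proof.
move=> PB; elim=> [|m IH] u s Pu /=; first exact: Pu.
by apply: (IH (fun s x => u s.+1 x - u s x)) => s'; apply: PB.
Qed.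

(** Newton's forward formula: the expansions at [j] of [u] and of its first difference add up by
    Pascal's rule. *)
Lemma newton_forward m u : (forall s, fdiff m u s = 0) ->
  forall j, u j = \sum_(k < m) fdiff k u 0 *+ 'C(j, k).
Proof.
move=> + j; elim: j u => [|j IH] u u0.
  case: m u0 => [u0|m _]; first by rewrite big_ord0; exact: (u0 0%N).
  by rewrite big_ord_recl bin0 mulr1n big1 ?addr0// => i _; rewrite bin0n.
have Du0 s : fdiff m (fun s => u s.+1 - u s) s = 0.
  by rewrite -[LHS]/(fdiff m.+1 u s) fdiffS !u0 subrr.
have := IH _ Du0 => /eqP; rewrite subr_eq => /eqP ->.
rewrite (IH u u0) -big_split/=.
case: m u0 {IH Du0} => [_|m u0]; first by rewrite !big_ord0.
rewrite big_split/= big_ord_recr/= -[fdiff m _ 0%N]/(fdiff m.+1 u 0%N) u0.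
rewrite mul0rn addr0 [X in _ + X]big_ord_recl [RHS]big_ord_recl !bin0 addrCA.
congr (_ + _); rewrite -big_split/=; apply: eq_bigr => i _.
by rewrite binS mulrnDr addrC.
Qed.

End FiniteDifferences.

(** * Vanishing on maxima of affine functions *)

Section PiecewiseAffine.
Context {R : realType} {n : nat} {F : tvsType R} {U : set 'rV[R]_n}.
Implicit Types (mu nu : ('rV[R]_n -> R) -> F) (f g h : 'rV[R]_n -> R).

(* With M = max(a, l), the functions s a + M and s M + l have maximum
   (s + 1) M and minimum s a + l. *)
Lemma valuation_dilate_max mu a l (s : nat) : invariant_valuation (U := U) mu ->
  ConvU U a -> ConvU U l -> affine_fun l ->
  let M := fun x => Num.max (a x) (l x) in
  mu (fun x => s.+1%:R * M x) - mu (fun x => s%:R * M x) =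
  mu (fun x => s%:R * a x + M x) - mu (fun x => s%:R * a x).
Proof.
move=> [vmu imu] ca cl al M.
have cM : ConvU U M by exact: ConvU_max.
have s0 : 0 <= s%:R :> R by [].
have maxE : (fun x => s.+1%:R * M x) =
    (fun x => Num.max (s%:R * a x + M x) (s%:R * M x + l x)).
  apply/funext => x; rewrite /M -natr1 mulrDl mul1r.
  case: (leP (a x) (l x)) => al_x.
    by rewrite max_r// lerD2r ler_wpM2l.
  by rewrite max_l// lerD2l ltW.
have minE : (fun x => s%:R * a x + l x) =
    (fun x => Num.min (s%:R * a x + M x) (s%:R * M x + l x)).
  apply/funext => x; rewrite /M.
  case: (leP (a x) (l x)) => al_x.
    by rewrite min_l// lerD2r ler_wpM2l.
  by rewrite min_r// lerD2l ltW.
have csa := ConvUZ _ _ _ s0 ca; have csM := ConvUZ _ _ _ s0 cM.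
have := vmu _ _ (ConvUD _ _ _ csa cM) (ConvUD _ _ _ csM cl).
rewrite -minE -maxE => /(_ (ConvUD _ _ _ csa cl)).
rewrite (imu _ _ csa al) (imu _ _ csM al) => H.
by apply/eqP; rewrite subr_eq addrAC -H addrK.
Qed.

(** One difference in [s] trades [mu] for [mu(. + M) - mu] and removes [p] from the maximum, whence
    induction on [ps]. *)
Lemma fdiff_dilate_max_affine mu p0 ps s : invariant_valuation (U := U) mu ->
  fdiff (size ps).+1 (fun s => mu (fun x => s%:R * max_affine p0 ps x)) s = 0.
Proof.
elim: ps mu s => [|p ps IH] mu s vmu.
  have c0 : ConvU U (fun=> 0) by apply/ConvUP => t x y _ _ _; rewrite !mulr0 addr0.
  have mu0 c : mu (fun x => c * affine p0 x) = mu (fun=> 0).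
    rewrite -(vmu.2 _ _ c0 (affine_funZ c _ (affine_funE p0))).
    by congr mu; apply/funext => x; rewrite add0r.
  by rewrite /= !mu0 subrr.
pose M := max_affine p0 (p :: ps).
rewrite (_ : fdiff _ _ _ = fdiff (size ps).+1 (fun s =>
    (fun f => mu (fun x => f x + M x) - mu f)
      (fun x => s%:R * max_affine p0 ps x)) s); last first.
  apply: (congr1 (fun v => fdiff (size ps).+1 v s)); apply/funext => k.
  by rewrite valuation_dilate_max//;
    [exact: ConvU_max_affine|exact: ConvU_affine|exact: affine_funE].
apply: (IH (fun f => mu (fun x => f x + M x) - mu f)); apply: invariant_valuationB => //.
by apply: invariant_valuation_translate => //; exact: ConvU_max_affine.
Qed.

(* The sum of (-1)^|T| nu(max(h, T)) over all sub-families T of qs. *)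
Fixpoint alternating_max nu h (qs : seq ('rV[R]_n * R)) : F :=
  if qs is q :: qs' then
    alternating_max nu h qs' -
    alternating_max nu (fun x => Num.max (h x) (affine q x)) qs'
  else nu h.

(* This is the valuation property at h v p and h v q, whose minimum is h. *)
Lemma alternating_max_exchange nu h p q qs : is_valuation U nu -> ConvU U h ->
  (forall x, Num.min (affine p x) (affine q x) <= h x) ->
  let hq := fun x => Num.max (h x) (affine q x) in
  alternating_max nu h (p :: qs) = alternating_max nu hq (p :: qs).
Proof.
move=> vnu + + hq; rewrite {}/hq.
elim: qs h => [|r qs IH] h ch pqh.
  have cp := ConvU_max _ _ _ ch (ConvU_affine U p).
  have cq := ConvU_max _ _ _ ch (ConvU_affine U q).
  have minE : (fun x => Num.min (Num.max (h x) (affine p x))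
      (Num.max (h x) (affine q x))) = h.
    by apply/funext => x; rewrite -max_minr max_l.
  have := vnu _ _ cp cq; rewrite minE => /(_ ch) H.
  have maxE : (fun x => Num.max (Num.max (h x) (affine q x)) (affine p x)) =
      (fun x => Num.max (Num.max (h x) (affine p x)) (Num.max (h x) (affine q x))).
    by apply/funext => x; rewrite [RHS]maxACA maxxx -maxA [Num.max (affine q x) _]maxC.
  rewrite /= maxE; apply/eqP; rewrite subr_eq; apply/eqP.
  by rewrite addrAC [_ + nu (fun x => Num.max _ (affine p x))]addrC -H addrAC subrr add0r.
pose hr := fun x => Num.max (h x) (affine r x).
have cr : ConvU U hr := ConvU_max _ _ _ ch (ConvU_affine U r).
have IHh := IH h ch pqh.
have IHr : alternating_max nu hr (p :: qs) =
    alternating_max nu (fun x => Num.max (hr x) (affine q x)) (p :: qs).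
  by apply: IH => // x; rewrite (le_trans (pqh x))// le_max lexx.
have maxC (a b : 'rV[R]_n * R) g :
  (fun x => Num.max (Num.max (g x) (affine a x)) (affine b x)) =
  (fun x => Num.max (Num.max (g x) (affine b x)) (affine a x)).
  by apply/funext => x; rewrite maxAC.
have consE g : alternating_max nu g [:: p, r & qs] =
    alternating_max nu g (p :: qs) -
    alternating_max nu (fun x => Num.max (g x) (affine r x)) (p :: qs).
  by rewrite /= (maxC p r) !opprB addrACA [RHS]addrACA; congr (_ + _); rewrite addrC.
by rewrite !consE IHh IHr /hr (maxC r q).
Qed.

(** Induction on [cs]: a single function lies below [h], so the two terms coincide; otherwise the
    mean of the tail can be absorbed into [h]. *)
Lemma alternating_max_eq0 nu h (cs : seq (R * ('rV[R]_n * R))) :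
  is_valuation U nu -> ConvU U h -> all (fun c => 0 < c.1) cs -> cs != [::] ->
  (forall x, \sum_(c <- cs) c.1 * affine c.2 x <= (\sum_(c <- cs) c.1) * h x) ->
  alternating_max nu h (map snd cs) = 0.
Proof.
move=> vnu; elim: cs h => // -[c p] cs IH h ch /= /andP[c0 cs0] _ csh.
have [cs_nil|cs_neq0] := eqVneq cs [::].
  move: csh; rewrite cs_nil /= => ph.
  rewrite (_ : (fun x => _) = h) ?subrr//; apply/funext => x; rewrite max_l//.
  by have := ph x; rewrite !big_seq1 /= ler_pM2l.
pose C := \sum_(c <- cs) c.1.
have C0 : 0 < C.
  rewrite /C; case: cs cs0 cs_neq0 {IH csh C} => // -[d r] cs /= /andP[d0 cs0] _.
  rewrite big_cons/= ltr_wpDr// big_seq sumr_ge0// => e ecs.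
  by apply/ltW/(allP cs0).
(* The weighted mean q of the tail satisfies min(p, q) <= h, and the tail
   fulfils the hypothesis over h v q. *)
pose q := (\sum_(c <- cs) (c.1 / C) *: c.2.1, \sum_(c <- cs) c.1 / C * c.2.2).
have qE x : C * affine q x = \sum_(c <- cs) c.1 * affine c.2 x.
  rewrite /q affine_comb mulr_sumr; apply: eq_bigr => e _.
  by rewrite mulrA mulrCA divff ?mulr1 ?gt_eqF.
have pqh x : Num.min (affine p x) (affine q x) <= h x.
  rewrite leNgt lt_min; apply/negP => /andP[hp hq].
  have := csh x; rewrite !big_cons/= -qE -/C => H.
  have := ltr_pM2l c0 (h x) (affine p x); rewrite hp => H1.
  have := ltr_pM2l C0 (h x) (affine q x); rewrite hq => H2.
  by move: H1 H2 H; lra.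
have cq := ConvU_max _ _ _ ch (ConvU_affine U q).
have := alternating_max_exchange nu h p q (map snd cs) vnu ch pqh.
(* With [q] absorbed, the tail has its mean below the new function, so [IH] kills both terms of the
   difference. *)
rewrite /= => ->; rewrite !IH ?subrr//.
  apply: ConvU_max => //; exact: ConvU_affine.
  by move=> x; rewrite -qE -/C ler_pM2l// !le_max lexx orbT.
by move=> x; rewrite -qE -/C ler_pM2l// !le_max lexx orbT.
Qed.

Lemma alternating_max_vanish nu m : 
  (forall p0 ps, (size ps < m)%N -> nu (max_affine p0 ps) = 0) ->
  forall p0 ps qs, (size ps + size qs < m)%N ->
    alternating_max nu (max_affine p0 ps) qs = 0.
Proof.
move=> nu0 p0 ps qs; elim: qs ps => [|q qs IH] ps; first by rewrite addn0; exact: nu0.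
rewrite /= => psqs; rewrite IH ?(IH (q :: ps)) ?subrr//=; lia.
Qed.

(** Of the [m.+1] functions, only the term using all of them escapes [nu0]. Moving heads of [qs]
    onto [ps] one by one reverses [qs]. *)
Lemma alternating_max_top nu m :
  (forall p0 ps, (size ps < m)%N -> nu (max_affine p0 ps) = 0) ->
  forall p0 ps qs, (size ps + size qs = m)%N ->
    alternating_max nu (max_affine p0 ps) qs = 0 ->
    nu (max_affine p0 (rev qs ++ ps)) = 0.
Proof.
move=> nu0 p0 ps qs; elim: qs ps => [|q qs IH] ps //= psqs.
rewrite (alternating_max_vanish nu m)//; last by lia.
move=> /eqP; rewrite sub0r oppr_eq0 => /eqP H.
by rewrite rev_cons cat_rcons; apply: IH => //=; lia.
Qed.

(** The vectors (a, 1), with a the linear parts, are at least n + 2 in dimension n + 1, hence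
    dependent; the column of ones gives the zero sum. A change of sign settles the last
    inequality. *)
Lemma affine_dependence (ps : seq ('rV[R]_n * R)) : (n.+2 <= size ps)%N ->
  exists c : 'I_(size ps) -> R,
    [/\ \sum_i c i = 0, exists i, c i != 0,
        \sum_i c i *: (tnth (in_tuple ps) i).1 = 0 &
        \sum_i c i * (tnth (in_tuple ps) i).2 <= 0].
Proof.
move=> sps.
suff [c [c0 cn0 ca]] : exists c : 'I_(size ps) -> R,
    [/\ \sum_i c i = 0, exists i, c i != 0 &
        \sum_i c i *: (tnth (in_tuple ps) i).1 = 0].
  have [cb|/ltW cb] := leP (\sum_i c i * (tnth (in_tuple ps) i).2) 0.
    by exists c.
  have [i ci] := cn0; exists (fun i => - c i); split.
  - by rewrite sumrN c0 oppr0.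
  - by exists i; rewrite oppr_eq0.
  - by under eq_bigr do rewrite scaleNr; rewrite sumrN ca oppr0.
  - by under eq_bigr do rewrite mulNr; rewrite sumrN oppr_le0.
pose A : 'M[R]_(size ps, n + 1) :=
  row_mx (\matrix_(i, j) (tnth (in_tuple ps) i).1 0 j) (const_mx 1).
have /rowV0Pn[v /sub_kermxP vA v0] : kermx A != 0.
  rewrite kermx_eq0 /row_free; apply/negP => /eqP rA.
  by have := rank_leq_col A; rewrite rA; lia.
move: vA; rewrite mul_mx_row -row_mx0 => /eq_row_mx [va v1].
exists (fun i => v 0 i); split.
- have := congr1 (fun B : 'M[R]_(1, 1) => B 0 0) v1; rewrite !mxE => H; rewrite -[RHS]H.
  by apply: eq_bigr => i _; rewrite mxE mulr1.
- have /rV0Pn[i vi] := v0; by exists i.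
- apply/rowP => j; have := congr1 (fun B : 'rV[R]_n => B 0 j) va.
  rewrite !mxE summxE => H; rewrite -[RHS]H.
  by apply: eq_bigr => i _; rewrite !mxE.
Qed.

Lemma vanish_max_affine nu : is_valuation U nu ->
  (forall p0 ps, (size ps <= n)%N -> nu (max_affine p0 ps) = 0) ->
  forall p0 ps, nu (max_affine p0 ps) = 0.
Proof.
move=> vnu nu0 p0 ps; have [m] := ubnP (size ps).
elim: m p0 ps => // m IH p0 ps; rewrite ltnS => psm.
(* [size ps] leaves out [p0]: in the second case there are at least n + 2 functions. *)
have [psn|psn] := leqP (size ps) n; first exact: nu0.
have [c [c0 [i0 ci0] ca cb]] := affine_dependence (p0 :: ps) psn.
pose p := tnth (in_tuple (p0 :: ps)).
pose J := [seq (c i, p i) | i <- enum 'I_(size (p0 :: ps)) & 0 < c i].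
pose I := [seq p i | i <- enum 'I_(size (p0 :: ps)) & ~~ (0 < c i)].
have IJ : perm_eq (p0 :: ps) (map snd J ++ I).
  rewrite /J /I -map_comp -map_cat.
  have {1}-> : p0 :: ps = map p (enum 'I_(size (p0 :: ps))).
    by rewrite -[LHS](map_tnth_enum (in_tuple (p0 :: ps))).
  by apply: perm_map; rewrite perm_sym perm_filterC.
have sumJ (G : R -> 'rV[R]_n * R -> R) :
    \sum_(e <- J) G e.1 e.2 = \sum_(i | 0 < c i) G (c i) (p i).
  by rewrite /J big_map big_filter big_enum_cond; apply: eq_bigl => i; rewrite inE.
have cN : \sum_(i | 0 < c i) c i = \sum_(i | ~~ (0 < c i)) - c i.
  apply/eqP; rewrite sumrN -subr_eq0 opprK; apply/eqP.
  by rewrite -[RHS]c0 [RHS](bigID (fun i => 0 < c i)).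
(* Coefficients with zero sum, not all zero, take both signs, so neither [J] nor [I] is empty. *)
have J0 : J != [::].
  apply/eqP => J0; have /eqP : \sum_i - c i = 0 by rewrite sumrN c0 oppr0.
  have cle i : c i <= 0.
    rewrite leNgt; apply/negP => ci; suff : (c i, p i) \in J by rewrite J0.
    by apply/mapP; exists i => //; rewrite mem_filter ci mem_enum.
  rewrite psumr_eq0 => [/allP/(_ i0)|i _]; last by rewrite oppr_ge0.
  by rewrite mem_index_enum oppr_eq0 (negbTE ci0) => /(_ isT).
case IE : I => [|q0 qs].
  have cgt i : 0 < c i.
    apply: contraT => ci; suff : p i \in I by rewrite IE.
    by apply/mapP; exists i => //; rewrite mem_filter ci mem_enum.
  have := c0; move/eqP; rewrite psumr_eq0 => [/allP/(_ i0)|i _]; last exact/ltW.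
  by rewrite mem_index_enum (negbTE ci0) => /(_ isT).
rewrite IE in IJ.
have -> : max_affine p0 ps = max_affine q0 (rev (map snd J) ++ qs).
  apply: max_affine_perm; apply: perm_trans IJ _.
  by rewrite perm_catC cat_cons perm_cons perm_catC perm_cat2r perm_sym perm_rev.
apply: (alternating_max_top nu (size ps)).
- by move=> r0 rs rs_ps; apply: IH; exact: leq_trans psm.
- by have := perm_size IJ; rewrite size_cat /= addnS => -[->]; rewrite addnC.
apply: alternating_max_eq0 => //; first exact: ConvU_max_affine.
  by apply/allP => e /mapP[i]; rewrite mem_filter => /andP[ci _] ->.
move=> x; rewrite (sumJ (fun a b => a * affine b x)) (sumJ (fun a _ => a)).
(* Splitting this sum by sign bounds the sum over [J] by one over [I] with weights [- c i], of the
   same total by [cN]. *)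
have caff : \sum_i c i * affine (p i) x <= 0.
  rewrite -affine_comb ca /affine /= big1 ?add0r// => j _.
  by rewrite mxE mul0r.
rewrite (bigID (fun i => 0 < c i))/= -lerBrDr sub0r -sumrN in caff.
apply: le_trans caff _; rewrite cN mulr_suml; apply: ler_sum => i ci.
rewrite -mulNr; apply: ler_wpM2l; first by rewrite oppr_ge0 leNgt.
apply: max_affine_ge; rewrite -IE.
by apply/mapP; exists i => //; rewrite mem_filter ci mem_enum.
Qed.

Lemma fdiff_dilate_max_affine_dim mu p0 ps s : invariant_valuation (U := U) mu ->
  fdiff n.+1 (fun s => mu (fun x => s%:R * max_affine p0 ps x)) s = 0.
Proof.
move=> vmu.
apply: (vanish_max_affine (fun f => fdiff n.+1 (fun s => mu (fun x => s%:R * f x)) s)).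
  apply: (fdiff_closed (is_valuation U) _ n.+1 (fun s f => mu (fun x => s%:R * f x))).
    move=> a b va vb f g cf cg cfg.
    by rewrite addrACA va// -opprD vb// opprD addrACA.
  by move=> k; apply: is_valuation_dilate vmu.1.
move=> q0 qs sqs; apply: fdiff_eq0 (fun s => fdiff_dilate_max_affine mu q0 qs s vmu) s.
by rewrite ltnS.
Qed.

End PiecewiseAffine.

(** * Subgradients, semicontinuity and density *)

Section Density.
Context {R : realType} {n : nat} {U : set 'rV[R]_n}.
Hypothesis openU : open U.
Hypothesis convexU : convex_set (U : set (convex_lmodType 'rV[R]_n)).
Implicit Types (f : 'rV[R]_n -> R) (x v a : 'rV[R]_n) (eps d t : R).

Lemma nbhs_rVP x (A : set 'rV[R]_n) : nbhs x A <->
  exists2 d, 0 < d & forall v, (forall i, `|v 0 i| < d) -> A (x + v).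
Proof.
split=> [/nbhs_ballP[d /= d0 xA]|[d d0 xA]].
  exists d => // v vd; apply: xA; split=> // i j.
  by rewrite (ord1 i) !mxE /ball/= opprD addrA subrr sub0r normrN.
apply/nbhs_ballP; exists d => // y [_ xy]; rewrite -[y](subrK x) addrC.
apply: xA => i; rewrite !mxE distrC; exact: xy.
Qed.

Let unit_row (k : 'I_n) : 'rV[R]_n := delta_mx 0 k.

Lemma unit_rowE (k i : 'I_n) : unit_row k 0 i = (i == k)%:R.
Proof. by rewrite mxE eqxx. Qed.

Lemma open_line x k : U x ->
  exists2 d, 0 < d & forall t, `|t| < d -> U (x + t *: unit_row k).
Proof.
move=> Ux; have /nbhs_rVP[d d0 xU] : nbhs x U by exact: open_nbhs_nbhs.
exists d => // t td; apply: xU => i; rewrite mxE unit_rowE.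
by case: eqP => _; rewrite ?mulr1// mulr0 normr0.
Qed.

Let dot a v := \sum_(i < n) a 0 i * v 0 i.

Let dotDr a v w : dot a (v + w) = dot a v + dot a w.
Proof. by rewrite /dot -big_split/=; apply: eq_bigr => i _; rewrite mxE mulrDr. Qed.

Let dotZr a c v : dot a (c *: v) = c * dot a v.
Proof. by rewrite /dot mulr_sumr; apply: eq_bigr => i _; rewrite mxE mulrCA. Qed.

(** The flag of coordinate subspaces, from zero to the whole space at [n], for inductions adding one
    coordinate at a time. *)
Let V k : set 'rV[R]_n := [set v | forall i : 'I_n, (k <= i)%N -> v 0 i = 0].

(* The one-dimensional extension step of the Hahn-Banach theorem. *)
Lemma subgradient_extend f x (k : 'I_n) a : ConvU U f -> U x ->
  (forall v, V k v -> U (x + v) -> f x + dot a v <= f (x + v)) ->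
  exists b, forall v t, V k v -> U (x + (v + t *: unit_row k)) ->
    f x + dot a v + t * b <= f (x + (v + t *: unit_row k)).
Proof.
move=> /ConvUP cf Ux af; set e := unit_row k.
(* Slopes forced by points on the negative side of [e]. Each is at most every slope on the positive
   side, so [sup S] serves as [b]. *)
pose S := [set r | exists v s, [/\ V k v, 0 < s, U (x + (v - s *: e)) &
  r = (f x + dot a v - f (x + (v - s *: e))) / s]].
have ST v t r : V k v -> 0 < t -> U (x + (v + t *: e)) -> S r ->
    r <= (f (x + (v + t *: e)) - f x - dot a v) / t.
  move=> Vv t0 Uv [w [s [Vw s0 Uw ->]]].
  rewrite ler_pdivrMr// mulrAC ler_pdivlMr//.
  have st : 0 < s + t by rewrite addr_gt0.
  (* The weight that cancels the components along [e], leaving [x] plus a vector of [V k], where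
     [af] applies. *)
  pose th := t / (s + t).
  have th01 : 0 <= th <= 1.
    by apply/andP; split; [rewrite divr_ge0 ?ltW|rewrite ler_pdivrMr// mul1r lerDr ltW].
  have thE : th * (s + t) = t by rewrite divfK// gt_eqF.
  have thE' : (1 - th) * (s + t) = s by rewrite mulrBl mul1r thE addrK.
  have xE : th *: (x + (w - s *: e)) + (1 - th) *: (x + (v + t *: e)) =
      x + (th *: w + (1 - th) *: v).
    have sth : th * s = (1 - th) * t by move: thE; rewrite mulrDr mulrBl mul1r; lra.
    rewrite !scalerDr scalerN !scalerA sth addrACA -scalerDl [th + _]addrC subrK scale1r.
    by congr (_ + _); rewrite addrACA addNr addr0.
  have := cf th _ _ th01 Uw Uv; rewrite xE => cfx.
  have Uth := convex_setP _ convexU th _ _ th01 Uw Uv; rewrite xE in Uth.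
  have := af (th *: w + (1 - th) *: v).
  rewrite dotDr !dotZr => /(_ _ Uth) af1.
  have {}af1 := le_trans (af1 _) cfx.
  have /af1 : V k (th *: w + (1 - th) *: v).
    by move=> i ki; rewrite !mxE Vw// Vv// !mulr0 addr0.
  rewrite -(ler_pM2r st) => af2.
  have thD g h : (th * g + (1 - th) * h) * (s + t) = t * g + s * h.
    by rewrite mulrDl mulrAC thE mulrAC thE'.
  rewrite [(f x + _) * _]mulrDl !thD in af2; lra.
have [d d0 dU] := open_line x k Ux.
have V0 : V k 0 by move=> i _; rewrite mxE.
have d2 : 0 < d / 2 by rewrite divr_gt0.
have dd2 : `|d / 2| < d by rewrite gtr0_norm// ltr_pdivrMr// mulrDr mulr1 ltrDl.
have S0 : S !=set0.
  exists ((f x + dot a 0 - f (x + (0 - (d / 2) *: e))) / (d / 2)), 0, (d / 2).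
  by split => //; rewrite add0r -scaleNr; apply: dU; rewrite normrN.
have Sub : has_ubound S.
  exists ((f (x + (0 + (d / 2) *: e)) - f x - dot a 0) / (d / 2)) => r Sr.
  by apply: ST => //; rewrite add0r; exact: dU.
exists (sup S) => v t Vv Uv.
have [t0|t0|t0] := ltgtP t 0.
- have Sr : S ((f x + dot a v - f (x + (v - (- t) *: e))) / (- t)).
    by exists v, (- t); split => //; rewrite ?oppr_gt0// scaleNr opprK.
  have := ub_le_sup Sub Sr; rewrite scaleNr opprK.
  by rewrite ler_pdivrMr ?oppr_gt0//; lra.
- have : sup S <= (f (x + (v + t *: e)) - f x - dot a v) / t.
    by apply: ge_sup => // r; exact: ST.
  by rewrite ler_pdivlMr//; lra.
- rewrite t0 scale0r addr0 mul0r addr0; apply: af => //.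
  by move: Uv; rewrite t0 scale0r addr0.
Qed.

(** The extension step, applied to each coordinate in turn from the zero subspace on, yields the
    slope [a]; touching [f] at [x] fixes the constant. *)
Lemma subgradient f x : ConvU U f -> U x ->
  exists p, affine p x = f x /\ forall y, U y -> affine p y <= f y.
Proof.
move=> cf Ux.
suff [a af] : exists a, forall v, V n v -> U (x + v) -> f x + dot a v <= f (x + v).
  exists (a, f x - dot a x); rewrite /affine /= -/(dot a x).
  split=> [|y Uy]; first by rewrite addrC subrK.
  have := af (y - x); rewrite [x + _]addrC subrK => /(_ _ Uy) {}af.
  rewrite -/(dot a y) -[y in dot a y](subrK x) dotDr.
  rewrite [leLHS](_ : _ = f x + dot a (y - x)); last by lra.
  by apply: af => i; rewrite leqNgt ltn_ord.
suff H k : (k <= n)%N ->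
    exists a, forall v, V k v -> U (x + v) -> f x + dot a v <= f (x + v).
  exact: H n (leqnn n).
elim: k => [|k IH] kn.
  exists 0 => v v0 _; have -> : v = 0 by apply/rowP => i; rewrite v0// mxE.
  by rewrite addr0 /dot big1 ?addr0// => i _; rewrite mxE mul0r.
have [a af] := IH (ltnW kn); pose k' := Ordinal kn.
have [b ab] := subgradient_extend f x k' a cf Ux af.
exists (\row_i (if i == k' then b else a 0 i)) => w Vw Uw.
pose t := w 0 k'; pose v := w - t *: unit_row k'.
have vk : v 0 k' = 0 by rewrite !mxE !eqxx mulr1 subrr.
have vE i : i != k' -> v 0 i = w 0 i.
  by move=> ik; rewrite !mxE (negbTE ik) andbF mulr0 subr0.
have Vv : V k' v.
  move=> i ki; have [->//|ik] := eqVneq i k'; rewrite vE// Vw//.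
  by rewrite ltn_neqAle ki andbT; apply: contra ik => /eqP ik; apply/eqP/val_inj.
have wE : w = v + t *: unit_row k' by rewrite subrK.
have := ab v t Vv; rewrite -wE => /(_ Uw); apply: le_trans.
rewrite -addrA lerD2l le_eqVlt; apply/orP; left; apply/eqP.
rewrite /dot (bigD1 k')//= [in RHS](bigD1 k')//= vk mulr0 add0r mxE eqxx addrC mulrC.
congr (_ + _); apply: eq_bigr => i ik; by rewrite mxE (negbTE ik) vE.
Qed.

(** Along the segments from [x] to [x + r *: e] and [x - r *: e], convexity bounds the increase of
    [f] by a fraction of [B]. *)
Lemma upper_semicontinuous_line f x k eps : ConvU U f -> U x -> 0 < eps ->
  exists2 d, 0 < d & forall t, `|t| < d ->
    U (x + t *: unit_row k) /\ f (x + t *: unit_row k) <= f x + eps.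
Proof.
move=> /ConvUP cf Ux eps0; have [d d0 dU] := open_line x k Ux.
set e := unit_row k; pose r := d / 2.
have r0 : 0 < r by rewrite divr_gt0.
have rd : `|r| < d by rewrite gtr0_norm// ltr_pdivrMr// mulrDr mulr1 ltrDl.
pose B := Num.max `|f (x + r *: e) - f x| `|f (x + (- r) *: e) - f x| + 1.
have B0 : 0 < B by rewrite ltr_wpDl// le_max normr_ge0.
have line s t : `|s| = r -> 0 <= t <= 1 -> f (x + s *: e) - f x <= B ->
    f (x + (t * s) *: e) <= f x + t * B.
  move=> sr t01 sB; have Us : U (x + s *: e) by apply: dU; rewrite sr -(gtr0_norm r0).
  have := cf t _ _ t01 Us Ux.
  rewrite scalerDr scalerA addrAC -scalerDl [t + _]addrC subrK scale1r.
  move=> /le_trans; apply.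
  have /andP[t0 _] := t01; have := ler_wpM2l t0 sB; lra.
exists (r * Num.min 1 (eps / B)).
  by rewrite mulr_gt0// lt_min ltr01 divr_gt0.
move=> t; rewrite mulrC -ltr_pdivrMr// lt_min => /andP[tr1 trB].
pose q := `|t| / r.
have q01 : 0 <= q <= 1.
  by apply/andP; split; [exact: divr_ge0 (normr_ge0 _) (ltW r0)|exact: ltW].
have qB : q * B <= eps by rewrite -ler_pdivlMr// ltW.
split.
  apply/dU/(lt_trans _ rd)/(lt_le_trans _ (ler_norm r)).
  by move: tr1; rewrite ltr_pdivrMr// mul1r.
have [t0|t0] := leP 0 t.
  have tE : t = q * r by rewrite /q ger0_norm// divfK// gt_eqF.
  rewrite tE; apply: le_trans (line r q _ q01 _) _; rewrite ?gtr0_norm ?lerD2l//.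
  rewrite (le_trans (ler_norm _))// /B ler_wpDr// le_max lexx//.
have tE : t = q * (- r) by rewrite /q ltr0_norm// mulrN divfK ?opprK// gt_eqF.
rewrite tE; apply: le_trans (line (- r) q _ q01 _) _;
  rewrite ?normrN ?gtr0_norm ?lerD2l//.
by rewrite (le_trans (ler_norm _))// /B ler_wpDr// le_max lexx orbT.
Qed.

(** Induction over coordinates: [x + w] is the midpoint of [x + 2 *: v], which involves one
    coordinate fewer, and a point on a coordinate line through [x]. *)
Lemma upper_semicontinuous f x eps : ConvU U f -> U x -> 0 < eps ->
  exists2 d, 0 < d & forall v, (forall i, `|v 0 i| < d) -> f (x + v) <= f x + eps.
Proof.
move=> cf Ux eps0.
suff [d d0 dU] : exists2 d, 0 < d & forall v, V n v ->
    (forall i, `|v 0 i| < d) -> U (x + v) /\ f (x + v) <= f x + eps.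
  have Vn v : V n v by move=> i; rewrite leqNgt ltn_ord.
  by exists d => // v vd; have [] := dU v (Vn v) vd.
suff H k : (k <= n)%N -> exists2 d, 0 < d & forall v, V k v ->
    (forall i, `|v 0 i| < d) -> U (x + v) /\ f (x + v) <= f x + eps.
  exact: H n (leqnn n).
elim: k => [|k IH] kn.
  exists 1 => // v v0 _; have -> : v = 0 by apply/rowP => i; rewrite v0// mxE.
  by rewrite addr0 lerDl ltW.
have [d d0 dU] := IH (ltnW kn); pose k' := Ordinal kn.
have [r r0 rU] := upper_semicontinuous_line f x k' eps cf Ux eps0.
(* Halved because both displacements are doubled. *)
exists (Num.min d r / 2); first by rewrite divr_gt0// lt_min d0.
move=> w Vw wd.
pose t := w 0 k'; pose v := w - t *: unit_row k'.
have vk : v 0 k' = 0 by rewrite !mxE !eqxx mulr1 subrr.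
have vE i : i != k' -> v 0 i = w 0 i.
  by move=> ik; rewrite !mxE (negbTE ik) andbF mulr0 subr0.
have Vv : V k (2 *: v).
  move=> i ki; rewrite mxE; have [->|ik] := eqVneq i k'; first by rewrite vk mulr0.
  rewrite vE// Vw ?mulr0//.
  by rewrite ltn_neqAle ki andbT; apply: contra ik => /eqP ik; apply/eqP/val_inj.
have wd2 i : 2 * `|w 0 i| < Num.min d r.
  by rewrite mulrC -ltr_pdivlMr.
have vd i : `|(2 *: v) 0 i| < d.
  rewrite mxE normrM ger0_norm//; have [->|ik] := eqVneq i k'.
    by rewrite vk normr0 mulr0.
  by rewrite vE//; have := wd2 i; rewrite lt_min => /andP[].
have tr : `|2 * t| < r.
  by rewrite normrM ger0_norm//; have := wd2 k'; rewrite lt_min => /andP[].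
have [U1 f1] := dU _ Vv vd; have [U2 f2] := rU _ tr.
have half01 : 0 <= (2^-1 : R) <= 1 by lra.
have h2 : 1 - 2^-1 = 2^-1 :> R by lra.
have xE : x + w = 2^-1 *: (x + 2 *: v) + (1 - 2^-1) *: (x + (2 * t) *: unit_row k').
  rewrite h2 !scalerDr !scalerA mulrA mulVf// mul1r scale1r addrACA -scalerDl.
  by rewrite (_ : 2^-1 + 2^-1 = 1) ?scale1r ?subrK//; lra.
rewrite xE; split; first exact: (convex_setP _ convexU).
have /ConvUP/(_ _ _ _ half01 U1 U2)/le_trans := cf; apply.
rewrite h2; lra.
Qed.

Lemma affine_continuous p x eps : 0 < eps ->
  exists2 d, 0 < d & forall v, (forall i, `|v 0 i| < d) ->
    affine p x - eps < affine p (x + v).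
Proof.
move=> eps0; pose A := \sum_(i < n) `|p.1 0 i| + 1.
have A0 : 0 < A by rewrite ltr_wpDl// sumr_ge0.
exists (eps / A); first by rewrite divr_gt0.
move=> v vd; rewrite affineD /affine addrA addrK.
rewrite [ltRHS](_ : _ = affine p x + \sum_(i < n) p.1 0 i * v 0 i); last first.
  by rewrite /affine; lra.
rewrite ltrD2l ltrNl (le_lt_trans (ler_norm _))// normrN.
apply: le_lt_trans (ler_norm_sum _ _ _) _.
apply: (@le_lt_trans _ _ (\sum_(i < n) `|p.1 0 i| * (eps / A))).
  by apply: ler_sum => i _; rewrite normrM ler_wpM2l// ltW.
rewrite -mulr_suml mulrCA -[ltRHS]mulr1 ltr_pM2l// ltr_pdivrMr// mul1r.
by rewrite /A ltrDl.
Qed.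

(** A supporting affine function at a point of [K] exceeds [f - eps] nearby. By compactness finitely
    many suffice, and their maximum stays below [f]. *)
Lemma max_affine_dense f (K : set 'rV[R]_n) eps : ConvU U f -> compact K ->
  K `<=` U -> 0 < eps ->
  exists p0 ps, forall x, K x -> `|max_affine p0 ps x - f x| < eps.
Proof.
move=> cf; rewrite compact_cover => cK KU eps0.
pose D := [set p | forall y, U y -> affine p y <= f y].
pose G p := [set x | f x - eps < affine p x]^°.
have [D' D'D KD'] : finite_subset_cover D G K.
  apply: cK => [p _|x Kx]; first exact: open_interior.
  have [p [px pf]] := subgradient f x cf (KU _ Kx).
  exists p => //; apply/nbhs_rVP.
  have eps2 : 0 < eps / 2 by rewrite divr_gt0.
  have [d1 d10 H1] := upper_semicontinuous f x (eps / 2) cf (KU _ Kx) eps2.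
  have [d2 d20 H2] := affine_continuous p x (eps / 2) eps2.
  exists (Num.min d1 d2); first by rewrite lt_min d10.
  move=> v vd /=; have {}H1 := H1 v; have {}H2 := H2 v.
  have /H1 : forall i, `|v 0 i| < d1.
    by move=> i; have := vd i; rewrite lt_min => /andP[].
  have /H2 : forall i, `|v 0 i| < d2.
    by move=> i; have := vd i; rewrite lt_min => /andP[].
  rewrite px; lra.
have D'P x : K x ->
    exists2 p, p \in (finmap.enum_fset D') & f x - eps < affine p x.
  by move=> /KD'[p /= pD' /interior_subset /= xp]; exists p.
have {D'D} D'D : {in (finmap.enum_fset D'), forall p, D p}.
  by move=> p pD'; exact/set_mem/D'D.
case: (finmap.enum_fset D') D'P D'D => [|p0 ps] D'P D'D.
  (* Nothing was selected, so [K] is empty and any pair will do. *)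
  by exists (0, 0), [::] => x /D'P[].
exists p0, ps => x Kx; have [p pps fp] := D'P x Kx.
have H1 : max_affine p0 ps x <= f x.
  by rewrite max_affine_le; apply/allP => q /D'D; apply; exact: KU.
have H2 : affine p x <= max_affine p0 ps x by exact: max_affine_ge.
by rewrite ler0_norm ?subr_le0//; lra.
Qed.

Lemma convex_bounded f (K : set 'rV[R]_n) : ConvU U f -> compact K ->
  K `<=` U -> exists B, forall x, K x -> `|f x| <= B.
Proof.
move=> cf cK KU; have [p0 [ps psf]] := max_affine_dense f K 1 cf cK KU ltr01.
have [M [_ /(_ (M + 1))]] := compact_bounded cK.
rewrite ltrDl ltr01 => /(_ isT) MK.
have aff p : exists B, forall x, K x -> `|affine p x| <= B.
  exists (\sum_(i < n) `|p.1 0 i| * (M + 1) + `|p.2|) => x Kx.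
  rewrite (le_trans (ler_normD _ _))// lerD2r (le_trans (ler_norm_sum _ _ _))//.
  apply: ler_sum => i _; rewrite normrM ler_wpM2l//.
  apply: le_trans (MK x Kx); rewrite {2}/Num.norm/= mx_normrE.
  exact: (le_bigmax _ (fun ij => `|x ij.1 ij.2|) (0, i)).
have [B BK] : exists B, forall x, K x -> `|max_affine p0 ps x| <= B.
  elim: ps {psf} => [|p ps [B IH]]; first exact: aff.
  have [C CK] := aff p; exists (B + C) => x Kx /=.
  have := IH x Kx; have := CK x Kx.
  by case: (leP (max_affine p0 ps x) (affine p x)) => _;
    have := normr_ge0 (affine p x); have := normr_ge0 (max_affine p0 ps x); lra.
exists (B + 1) => x Kx; have := BK x Kx; have := psf x Kx.
have := ler_normB (max_affine p0 ps x) (max_affine p0 ps x - f x).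
rewrite opprB addrC subrK; lra.
Qed.

End Density.

(** * Continuity of valuations and of dilation *)

Section Continuity.
Context {R : realType} {n : nat} {F : tvsType R} {U : set 'rV[R]_n}.
Implicit Types (mu nu : ('rV[R]_n -> R) -> F) (f g h : 'rV[R]_n -> R).

(** A filter on all functions, tested only on convex ones, which turns [conv_continuous] into
    convergence and opens the general limit rules. *)
Definition conv_nbhs f : set_system ('rV[R]_n -> R) :=
  [set A | exists (K : set 'rV[R]_n) (eps : R),
    [/\ compact K, K `<=` U, 0 < eps &
      forall g, ConvU U g -> (forall x, K x -> `|g x - f x| < eps) -> A g]].

#[local] Instance conv_nbhs_filter f : Filter (conv_nbhs f).
Proof.
split=> [|A B [K [e [cK KU e0 KA]]] [L [d [cL LU d0 LB]]]|A B AB].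
- exists set0, 1; split => //; exact: compact0.
- exists (K `|` L), (Num.min e d); split.
  + exact: compactU.
  + by move=> x [/KU|/LU].
  + by rewrite lt_min e0.
  + move=> g cg gKL; split; [apply: KA|apply: LB] => // x xK.
      by have := gKL x (or_introl xK); rewrite lt_min => /andP[].
    by have := gKL x (or_intror xK); rewrite lt_min => /andP[].
- move=> [K [e [cK KU e0 KA]]]; exists K, e; split => // g cg gK.
  exact/AB/KA.
Qed.

Lemma conv_continuousP mu : conv_continuous U mu <->
  forall f, ConvU U f -> mu g @[g --> conv_nbhs f] --> mu f.
Proof. by []. Qed.

Lemma conv_continuousB mu nu : conv_continuous U mu -> conv_continuous U nu ->
  conv_continuous U (fun f => mu f - nu f).
Proof.
move=> /conv_continuousP cmu /conv_continuousP cnu.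
apply/conv_continuousP => f cf.
apply: (cvg_comp2 (cmu f cf) (cnu f cf) (h := fun x y => x - y)).
exact: (@sub_continuous F (mu f, nu f)).
Qed.

Lemma conv_continuous_sum (I : finType) (a : I -> R)
    (mu : I -> ('rV[R]_n -> R) -> F) :
  (forall i, conv_continuous U (mu i)) ->
  conv_continuous U (fun f => \sum_i a i *: mu i f).
Proof.
move=> cmu; apply/conv_continuousP => f cf.
apply: cvg_big => [|i _]; first exact: add_continuous.
have /conv_continuousP/(_ f cf) cmui := cmu i.
apply: (cvg_comp2 (cvg_cst (a i : R^o)) cmui (h := fun x y => x *: y)).
exact: (@scale_continuous R F (a i, mu i f)).
Qed.

Lemma conv_continuous_dilate mu c : 0 <= c -> conv_continuous U mu ->
  conv_continuous U (fun f => mu (fun x => c * f x)).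
Proof.
move=> c0 cmu f cf W /(cmu _ (ConvUZ _ _ _ c0 cf))[K [e [cK KU e0 KW]]].
(* [c + 1] can be divided by even when [c] is zero. *)
have c1 : 0 < c + 1 by rewrite ltr_wpDl.
exists K, (e / (c + 1)); split => //; first by rewrite divr_gt0.
move=> g cg gf; apply: KW; first exact: ConvUZ.
move=> x Kx; have := gf x Kx; rewrite -mulrBr normrM ger0_norm// ltr_pdivlMr//.
have := normr_ge0 (g x - f x); nra.
Qed.

Lemma VConv_sum (I : finType) (a : I -> R) (mu : I -> ('rV[R]_n -> R) -> F) :
  (forall i, VConv U (mu i)) -> VConv U (fun f => \sum_i a i *: mu i f).
Proof.
move=> vmu; split.
- by apply: is_valuation_sum => i; case: (vmu i).
- by apply: conv_continuous_sum => i; case: (vmu i).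
- by apply: invariant_sum => i; case: (vmu i).
Qed.

Lemma VConv_dilate mu c : 0 <= c -> VConv U mu ->
  VConv U (fun f => mu (fun x => c * f x)).
Proof.
move=> c0 [vmu cmu imu]; split.
- exact: is_valuation_dilate.
- exact: conv_continuous_dilate.
- exact: invariant_dilate.
Qed.

Hypothesis hausF : hausdorff_space F.
Hypothesis openU : open U.
Hypothesis convexU : convex_set (U : set (convex_lmodType 'rV[R]_n)).

(** By density every neighbourhood of [mu f] contains 0, and [F] is Hausdorff. *)
Lemma conv_continuous_eq0 mu : conv_continuous U mu ->
  (forall p0 ps, mu (max_affine p0 ps) = 0) -> forall f, ConvU U f -> mu f = 0.
Proof.
move=> cmu mu0 f cf; apply: hausF => A B muA B0.
have [K [e [cK KU e0 KA]]] := cmu f cf A muA.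
have [p0 [ps psf]] := max_affine_dense openU convexU f K e cf cK KU e0.
exists 0; split; last exact: nbhs_singleton B0.
rewrite -(mu0 p0 ps); apply: KA => //; exact: ConvU_max_affine.
Qed.

Lemma fdiff_dilate mu f s : VConv U mu -> ConvU U f ->
  fdiff n.+1 (fun s => mu (fun x => s%:R * f x)) s = 0.
Proof.
move=> [vmu cmu imu] cf; apply: (conv_continuous_eq0
    (fun f => fdiff n.+1 (fun s => mu (fun x => s%:R * f x)) s)) => //.
  apply: (fdiff_closed (conv_continuous U) conv_continuousB n.+1
    (fun s f => mu (fun x => s%:R * f x))) => k.
  exact: conv_continuous_dilate.
by move=> p0 ps; apply: (fdiff_dilate_max_affine_dim (U := U)).
Qed.

Lemma dilate_continuous mu f t : VConv U mu -> ConvU U f -> 0 <= t ->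
  forall W, nbhs (mu (fun x => t * f x)) W ->
  exists2 d, 0 < d & forall s, 0 <= s -> `|s - t| < d -> W (mu (fun x => s * f x)).
Proof.
move=> [_ cmu _] cf t0 W /(cmu _ (ConvUZ _ _ _ t0 cf))[K [e [cK KU e0 KW]]].
have [B BK] := convex_bounded openU convexU f K cf cK KU.
have B1 : 0 < `|B| + 1 by rewrite ltr_wpDl.
exists (e / (`|B| + 1)); first by rewrite divr_gt0.
move=> s s0; rewrite ltr_pdivlMr// => st; apply: KW; first exact: ConvUZ.
move=> x Kx; rewrite -mulrBl normrM; apply: le_lt_trans st.
rewrite ler_wpM2l// (le_trans (BK x Kx))// (le_trans (ler_norm B))//.
by rewrite lerDl.
Qed.

End Continuity.

(** * Polynomial interpolation at the nodes 0, ..., n *)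

Section Interpolation.
Context {R : realType} (n : nat) {F : lmodType R}.

(** The weights that recover the coefficient of degree [k] of a polynomial of degree at most n from
    its values at the nodes [i]. *)
Definition interp_coef (k i : 'I_n.+1) : R :=
  invmx (Vandermonde n.+1 (\row_(j < n.+1) j%:R)) i k.

Lemma interp_coefE (k j : 'I_n.+1) :
  \sum_i interp_coef k i * i%:R ^+ j = (j == k)%:R.
Proof.
set V := Vandermonde n.+1 (\row_(j < n.+1) j%:R : 'rV[R]_n.+1).
have /mulmxV/matrixP/(_ j k) : V \in unitmx.
  rewrite unitmxE det_Vandermonde unitfE; apply/prodf_neq0 => i _.
  apply/prodf_neq0 => l il; rewrite !mxE subr_eq0 eqr_nat.
  by rewrite gt_eqF.
rewrite !mxE => <-; apply: eq_bigr => i _; rewrite mulrC; congr (_ * _).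
by rewrite !mxE.
Qed.

Lemma interp_coefK (x : 'I_n.+1 -> F) k :
  \sum_i interp_coef k i *: (\sum_(j < n.+1) i%:R ^+ j *: x j) = x k.
Proof.
under eq_bigr do rewrite scaler_sumr.
rewrite exchange_big/= (bigD1 k)//= [X in _ + X]big1 ?addr0 => [|j jk].
  under eq_bigr do rewrite scalerA.
  by rewrite -scaler_suml interp_coefE eqxx scale1r.
under eq_bigr do rewrite scalerA.
by rewrite -scaler_suml interp_coefE (negbTE jk) scale0r.
Qed.

Lemma bin_poly k : exists P : {poly R}, (size P <= k.+1)%N /\
  forall j : nat, P.[j%:R] = 'C(j, k)%:R.
Proof.
exists (k`!%:R^-1 *: \prod_(i < k) ('X - (i%:R)%:P)); split.
  apply: leq_trans (size_scale_leq _ _) _.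
  by rewrite size_prod_XsubC /index_enum -enumT size_enum_ord.
move=> j; rewrite hornerZ horner_prod.
have -> : \prod_(i < k) ('X - (i%:R)%:P).[j%:R] = (j ^_ k)%:R :> R.
  elim: k => [|k IH]; first by rewrite big_ord0.
  rewrite big_ord_recr/= IH hornerXsubC ffactnSr natrM.
  have [kj|jk] := leqP k j; first by rewrite natrB.
  by rewrite ffact_small// !mul0r.
by rewrite -bin_ffact natrM mulrC mulfK// pnatr_eq0 -lt0n fact_gt0.
Qed.

(** Newton's formula writes [u j] through binomials, which are polynomials in [j] of degree below
    [m]; collecting powers gives [x]. *)
Lemma fdiff_eq0_poly m (u : nat -> F) : (forall s, fdiff m u s = 0) ->
  exists x : 'I_m -> F, forall j, u j = \sum_(k < m) j%:R ^+ k *: x k.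
Proof.
move=> u0; have [P PE] := choice bin_poly.
exists (fun i => \sum_(k < m) (P k)`_i *: fdiff k u 0) => j.
rewrite (newton_forward m u u0).
under [RHS]eq_bigr do rewrite scaler_sumr.
rewrite exchange_big/=; apply: eq_bigr => k _.
have [sP Pj] := PE k.
rewrite -scaler_nat -Pj (horner_coef_wide _ (leq_trans sP (ltn_ord k))).
by rewrite scaler_suml; apply: eq_bigr => i _; rewrite scalerA mulrC.
Qed.

End Interpolation.

(** * The homogeneous decomposition *)

Section Decomposition.
Context {R : realType} {n : nat} {F : tvsType R} {U : set 'rV[R]_n}.
Hypothesis hausF : hausdorff_space F.
Hypothesis openU : open U.
Hypothesis convexU : convex_set (U : set (convex_lmodType 'rV[R]_n)).
Implicit Types (mu nu : ('rV[R]_n -> R) -> F) (f g h : 'rV[R]_n -> R).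

(** As a finite combination of integer dilates of [mu], it inherits membership in [VConv]. *)
Definition homogeneous_part mu (k : 'I_n.+1) f : F :=
  \sum_(i < n.+1) interp_coef n k i *: mu (fun x => i%:R * f x).

Lemma VConv_homogeneous_part mu k : VConv U mu -> VConv U (homogeneous_part mu k).
Proof.
move=> vmu; apply: (VConv_sum _ (interp_coef n k)
  (fun (i : 'I_n.+1) f => mu (fun x => i%:R * f x))) => i.
exact: VConv_dilate.
Qed.

Lemma dilate_rational mu f j N : VConv U mu -> ConvU U f -> (0 < N)%N ->
  mu (fun x => j%:R / N%:R * f x) =
  \sum_(k < n.+1) (j%:R / N%:R) ^+ k *: homogeneous_part mu k f.
Proof.
move=> vmu cf N0.
have Nn0 : N%:R != 0 :> R by rewrite pnatr_eq0 -lt0n.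
have vN : VConv U (fun f => mu (fun x => N%:R^-1 * f x)).
  by apply: VConv_dilate => //; rewrite invr_ge0.
have [y yE] := fdiff_eq0_poly n.+1 _
  (fun s => fdiff_dilate hausF openU convexU _ f s vN cf).
have muE i : mu (fun x => i%:R / N%:R * f x) = \sum_(k < n.+1) i%:R ^+ k *: y k.
  by rewrite -yE; congr mu; apply/funext => x; rewrite mulrA [_^-1 * _]mulrC.
(* The integer [i] is [(i * N) / N], so the polynomial found for [N] also gives the integer dilates,
   with coefficients [N%:R ^+ k *: y k]. *)
have partE k : homogeneous_part mu k f = N%:R ^+ k *: y k.
  rewrite -[RHS](interp_coefK n (fun k => N%:R ^+ k *: y k)).
  apply: eq_bigr => i _; congr (_ *: _).
  have -> : (fun x => i%:R * f x) = (fun x => (i * N)%:R / N%:R * f x).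
    by apply/funext => x; rewrite natrM mulfK.
  by rewrite muE; apply: eq_bigr => l _; rewrite scalerA natrM exprMn.
rewrite muE; apply: eq_bigr => k _.
by rewrite partE scalerA expr_div_n divfK// expf_neq0.
Qed.

(** Both sides are continuous in [t] and agree at nonnegative rationals; as [F] is Hausdorff they
    agree everywhere. *)
Lemma dilate_homogeneous_part mu f t : VConv U mu -> ConvU U f -> 0 <= t ->
  mu (fun x => t * f x) = \sum_(k < n.+1) t ^+ k *: homogeneous_part mu k f.
Proof.
move=> vmu cf t0; apply: hausF => A B muA PB.
have [d d0 dA] := dilate_continuous openU convexU mu f t vmu cf t0 A muA.
pose P (s : R) : F := \sum_(k < n.+1) s ^+ k *: homogeneous_part mu k f.
have cP : P s @[s --> t] --> P t.
  apply: cvg_big => [|i _]; first exact: add_continuous.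
  apply: (cvg_comp2 (@exprn_continuous R i t)
    (cvg_cst (homogeneous_part mu i f)) (h := fun (x : R^o) y => x *: y)).
  exact: (@scale_continuous R F (t ^+ i, homogeneous_part mu i f)).
have /nbhs_ballP[e /= e0 eB] := cP _ PB.
pose m := Num.min d e; have m0 : 0 < m by rewrite lt_min d0.
(* [j / N] is [t] rounded down to a multiple of [1 / N], with [1 / N] below [m]. *)
pose N := (Num.truncn m^-1).+1; pose j := Num.truncn (t * N%:R).
have N0 : 0 < N%:R :> R by rewrite ltr0n.
have mN : N%:R^-1 < m.
  by rewrite invf_plt ?posrE//; exact: truncnS_gt.
have jt : `|j%:R / N%:R - t| < m.
  apply: le_lt_trans mN; have tN : 0 <= t * N%:R by exact: mulr_ge0 t0 (ltW N0).
  have /andP[j1 j2] := truncn_itv tN; rewrite -/j in j1 j2.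
  rewrite ler_norml -(ler_pM2r N0) -[X in _ && X](ler_pM2r N0).
  rewrite mulNr mulrBl mulVf ?divfK ?gt_eqF//.
  by move: j1 j2; rewrite -natr1; lra.
move: jt; rewrite lt_min => /andP[jd je].
exists (mu (fun x => j%:R / N%:R * f x)); split.
  by apply: dA => //; rewrite divr_ge0.
rewrite dilate_rational//; apply: eB.
by rewrite /ball/= distrC.
Qed.

(** Expanding [mu] at [(i * t) f] in powers of [i] gives coefficients
    [t ^+ k *: homogeneous_part mu k f], and interpolation reads them off. *)
Lemma VConv_k_homogeneous_part mu (k : 'I_n.+1) : VConv U mu ->
  VConv_k U k (homogeneous_part mu k).
Proof.
move=> vmu; split; first exact: VConv_homogeneous_part.
move=> f t cf t0.
rewrite -[RHS](interp_coefK n (fun k => t ^+ k *: homogeneous_part mu k f)).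
apply: eq_bigr => i _; congr (_ *: _).
under eq_bigr do rewrite scalerA -exprMn.
rewrite -dilate_homogeneous_part ?mulr_ge0//.
by congr mu; apply/funext => x; rewrite mulrA.
Qed.

(** At the dilates [i f] both sums become polynomials in [i] with coefficients [nu k f] and
    [nu' k f], which interpolation recovers. *)
Lemma homogeneous_sum_inj (nu nu' : 'I_n.+1 -> ('rV[R]_n -> R) -> F) :
  (forall k : 'I_n.+1, VConv_k U k (nu k)) ->
  (forall k : 'I_n.+1, VConv_k U k (nu' k)) ->
  (forall f, ConvU U f -> \sum_(k < n.+1) nu k f = \sum_(k < n.+1) nu' k f) ->
  forall k f, ConvU U f -> nu k f = nu' k f.
Proof.
move=> vnu vnu' nunu' k f cf.
rewrite -(interp_coefK n (nu^~ f)) -(interp_coefK n (nu'^~ f)).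
apply: eq_bigr => i _; congr (_ *: _).
have i0 : 0 <= i%:R :> R by [].
have := nunu' _ (ConvUZ _ _ _ i0 cf).
under eq_bigr do rewrite (vnu _).2//.
by under [in RHS]eq_bigr do rewrite (vnu' _).2//.
Qed.

End Decomposition.

(* VConv(U,F) = (+)_{k=0}^n VConv_k(U,F): sums of homogeneous components lie in
   VConv, every element decomposes, and the decomposition is unique
   (valuations are compared on Conv(U,R)). *)
Theorem theorem3p2 (R : realType) (n : nat) (F : tvsType R)
  (U : set 'rV[R]_n) :
  hausdorff_space F -> open U -> convex_set (U : set (convex_lmodType 'rV[R]_n)) ->
  [/\ (forall nu : 'I_n.+1 -> ('rV[R]_n -> R) -> F,
         (forall k : 'I_n.+1, VConv_k U k (nu k)) ->
         VConv U (fun f => \sum_(k < n.+1) nu k f)),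
      (forall mu : ('rV[R]_n -> R) -> F, VConv U mu ->
         exists nu : 'I_n.+1 -> ('rV[R]_n -> R) -> F,
           (forall k : 'I_n.+1, VConv_k U k (nu k)) /\
           (forall f, ConvU U f -> mu f = \sum_(k < n.+1) nu k f)) &
      (forall nu nu' : 'I_n.+1 -> ('rV[R]_n -> R) -> F,
         (forall k : 'I_n.+1, VConv_k U k (nu k)) ->
         (forall k : 'I_n.+1, VConv_k U k (nu' k)) ->
         (forall f, ConvU U f ->
            \sum_(k < n.+1) nu k f = \sum_(k < n.+1) nu' k f) ->
         forall (k : 'I_n.+1) f, ConvU U f -> nu k f = nu' k f)].

Proof.
move=> hausF openU convexU; split.
- move=> nu vnu.
  rewrite (_ : (fun f => _) = (fun f => \sum_(k < n.+1) 1 *: nu k f)); last first.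
    by apply/funext => f; apply: eq_bigr => k _; rewrite scale1r.
  by apply: VConv_sum => k; exact: (vnu k).1.
- move=> mu vmu; exists (homogeneous_part mu); split=> [k|f cf].
    exact: VConv_k_homogeneous_part.
  have := dilate_homogeneous_part hausF openU convexU mu f 1 vmu cf ler01.
  under eq_bigr do rewrite expr1n scale1r.
  by move=> <-; congr mu; apply/funext => x; rewrite mul1r.
- exact: homogeneous_sum_inj.
Qed.
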